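(* Let $r_1,\dots,r_4\in\mathbb{C}$ and $s_1,\dots,s_6\in\mathbb{C}\setminus\{0\}$. Let $\mathbb{B}=\mathbb{B}(r_1,\dots,r_4;s_1,\dots,s_6)$, acting as a bounded linear operator on $c_0$. Then the continuous spectrum of $\mathbb{B}$ is $$\sigma_c(\mathbb{B},c_0)=\left\{\lambda\in\mathbb{C}: (|\lambda-r_1||\lambda-r_2||\lambda-r_3||\lambda-r_4|)^{1/4}= (|s_1||s_2||s_3||s_4||s_5||s_6|)^{1/6}\right\}.$$
   Context: $c_0$ is the Banach space of complex sequences $x=(x_k)_{k\ge 0}$ converging to $0$, with the supremum norm. For an integer $a$ and $n\in\mathbb{N}$, $a\,(\mathrm{mod}\ n)$ denotes the remainder in $\{0,\dots,n-1\}$ of $a$ modulo $n$. The matrix $\mathbb{B}(r_1,\dots,r_4;s_1,\dots,s_6)=(b_{ij})_{i,j\ge 0}$ is the infinite lower triangular matrix with $b_{ij}=r_{j(\mathrm{mod}\ 4)+1}$ if $i=j$, $b_{ij}=s_{j(\mathrm{mod}\ 6)+1}$ if $i=j+1$, and $b_{ij}=0$ otherwise; it acts on sequences by $(\mathbb{B}x)_k=\sum_{j}b_{kj}x_j$. The continuous spectrum $\sigma_c(T,X)$ is the set of $\lambda\in\mathbb{C}$ for which $T-\lambda I$ is injective on $X$ and has dense range, but the inverse $(T-\lambda I)^{-1}$ (defined on the range) is not bounded. *)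

(* Defs.v *)
From HB Require Import structures.
From mathcomp Require Import all_boot all_order all_algebra.
From mathcomp Require Import all_classical all_reals all_analysis.
From mathcomp Require Export complex.

Set Implicit Arguments.
Unset Strict Implicit.
Unset Printing Implicit Defensive.

Import Order.TTheory GRing.Theory Num.Theory.
Import numFieldNormedType.Exports.

Local Open Scope classical_set_scope.
Local Open Scope ring_scope.

Section ContinuousSpectrum.
Variables (K : numFieldType) (X : normedModType K).

Definition resolvent_map (T : X -> X) (l : K) : X -> X :=
  fun x => T x - l *: x.

(* [cancel S g] makes g an inverse of S on [range S]; the values of g outside
   [range S] are irrelevant *)
Definition has_bounded_inverse (S : X -> X) : Prop :=
  exists2 g : X -> X, cancel S g &
    exists M : K, forall y, range S y -> `|g y| <= M * `|y|.

Definition continuous_spectrum (T : {linear X -> X}) : set K :=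
  [set l | [/\ injective (resolvent_map T l),
               dense (range (resolvent_map T l))
             & ~ has_bounded_inverse (resolvent_map T l)]].

End ContinuousSpectrum.

Section C0.
Variable R : realType.
(* The regular module R[i]^o is the copy of R[i] that carries the topology
   induced by the modulus. *)
Local Notation C := (R[i]^o).

Definition c0_pred : {pred nat -> C} :=
  mem [set x : nat -> C | x @ \oo --> (0 : C)].

Record c0 := C0 { c0_val :> nat -> C ; _ : c0_val \in c0_pred }.

HB.instance Definition _ := [isSub for c0_val].
HB.instance Definition _ := [Choice of c0 by <:].

Lemma c0_submod_closed : submod_closed c0_pred.
Proof.
split; first by rewrite inE /=; exact: cvg_cst.
move=> a x y; rewrite !inE /= => x0 y0.
have := cvgD (cvgZl_tmp (k := a) x0) y0.
by rewrite scaler0 addr0; exact.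
Qed.

HB.instance Definition _ :=
  GRing.isSubmodClosed.Build R[i] (nat -> C) c0_pred c0_submod_closed.
HB.instance Definition _ := [SubChoice_isSubLmodule of c0 by <:].

Lemma c0_cvg (x : c0) : (x : nat -> C) @ \oo --> (0 : C).
Proof. by have := valP x; rewrite inE. Qed.

(* The supremum is taken in R and then embedded into R[i], since a normed space
   over the field R[i] has its norm valued in R[i]. *)
Definition c0_sup (x : c0) : R := sup (range (fun k => Normc.normc (x k))).
Definition c0_norm (x : c0) : R[i] := (c0_sup x)%:C%C.

Let normcE (z : C) : `|z| = (Normc.normc z)%:C%C.
Proof. by []. Qed.

Lemma c0_has_sup (x : c0) : has_sup (range (fun k => Normc.normc (x k))).
Proof.
split; first by exists (Normc.normc (x 0%N)), 0%N.
have /cvgr0Pnorm_lt /(_ 1 ltr01) [N _ HN] := @c0_cvg x.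
exists (1 + \sum_(k < N) Normc.normc (x k)) => _ [k _ <-].
have n0 (z : C) : 0 <= Normc.normc z by rewrite -lecR -normcE; exact: normr_ge0.
have [Nk|kN] := leqP N k.
  have := HN k Nk; rewrite /= normcE ltcR => /ltW h.
  by rewrite (le_trans h)// lerDl sumr_ge0.
rewrite (bigD1 (Ordinal kN)) //= addrCA lerDl addr_ge0 ?sumr_ge0//.
Qed.

Lemma c0_sup_ub (x : c0) k : Normc.normc (x k) <= c0_sup x.
Proof. by apply: sup_upper_bound; [exact: c0_has_sup|exists k]. Qed.

Lemma c0_sup_le (x : c0) (M : R) :
  (forall k, Normc.normc (x k) <= M) -> c0_sup x <= M.
Proof.
by move=> xM; apply: ge_sup; [exact: (c0_has_sup x).1|move=> _ [k _ <-]].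
Qed.

Lemma c0_norm_ub (x : c0) k : `|x k| <= c0_norm x.
Proof. by rewrite normcE lecR c0_sup_ub. Qed.

Lemma c0_norm_le (x : c0) (M : R[i]) :
  (forall k, `|x k| <= M) -> c0_norm x <= M.
Proof.
move=> xM; have M0 : 0 <= M by exact: le_trans (normr_ge0 _) (xM 0%N).
have ME : M = (complex.Re M)%:C%C by rewrite RRe_real// ger0_real.
rewrite ME lecR; apply: c0_sup_le => k.
by rewrite -lecR -ME -normcE.
Qed.

Lemma c0_normD (x y : c0) : c0_norm (x + y) <= c0_norm x + c0_norm y.
Proof.
apply: c0_norm_le => k; rewrite (le_trans (ler_normD _ _))//.
by rewrite lerD ?c0_norm_ub.
Qed.

Lemma c0_normZ (l : R[i]) (x : c0) : c0_norm (l *: x) = `|l| * c0_norm x.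
Proof.
have le1 (a : R[i]) (y : c0) : c0_norm (a *: y) <= `|a| * c0_norm y.
  apply: c0_norm_le => k; rewrite [X in `|X|](_ : _ = a * y k)//.
  by rewrite normrM ler_wpM2l ?c0_norm_ub.
have [->|l0] := eqVneq l 0.
  apply/eqP; rewrite eq_le le1 normr0 mul0r.
  exact: le_trans (normr_ge0 ((0 *: x : c0) 0%N)) (c0_norm_ub _ _).
apply/eqP; rewrite eq_le le1 /= -ler_pdivlMl ?normr_gt0//.
by rewrite -normfV -[X in c0_norm X <= _](scalerK l0) le1.
Qed.

Lemma c0_norm0_eq0 (x : c0) : c0_norm x = 0 -> x = 0.
Proof.
move=> x0; apply/val_inj/funext => k /=; apply/eqP.
by rewrite -normr_le0 -x0 c0_norm_ub.
Qed.

HB.instance Definition _ :=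
  Lmodule_isNormed.Build R[i] c0 c0_normD c0_normZ c0_norm0_eq0.

End C0.

Section OperatorB.
Variable R : realType.
Local Notation C := (R[i]^o).
Variables (r : 'I_4 -> R[i]) (s : 'I_6 -> R[i]).

(* r i and s i stand for r_{i+1} and s_{i+1} *)
Definition B_mx (i j : nat) : R[i] :=
  if i == j then r (inord (j %% 4))
  else if i == j.+1 then s (inord (j %% 6)) else 0.

(* B_mx is lower triangular, so the sum over all j stops at j = k *)
Definition B_seq (x : nat -> C) : nat -> C :=
  fun k => \sum_(j < k.+1) B_mx k j * x j.

Lemma B_seq0 x : B_seq x 0 = r (inord 0) * x 0%N.
Proof. by rewrite /B_seq big_ord1 /B_mx eqxx. Qed.

Lemma B_seqS x k :
  B_seq x k.+1 =
  r (inord (k.+1 %% 4)) * x k.+1 + s (inord (k %% 6)) * x k.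
Proof.
rewrite /B_seq 2!big_ord_recr /= big1 ?add0r => [|i _].
  by rewrite /B_mx !eqxx (gtn_eqF (ltnSn k)) addrC.
have ik : (i < k)%N by [].
by rewrite /B_mx eqSS (gtn_eqF ik) (gtn_eqF (ltn_trans ik (ltnSn k))) mul0r.
Qed.

Definition B_bound : R[i] := \sum_i `|r i| + \sum_i `|s i|.

Lemma B_seq_le x (M : R[i]) k : (forall j, (k.-1 <= j)%N -> `|x j| <= M) ->
  `|B_seq x k| <= B_bound * M.
Proof.
move=> xM; have M0 : 0 <= M := le_trans (normr_ge0 _) (xM _ (leqnn _)).
have rle i : `|r i| <= \sum_i `|r i|.
  by rewrite (bigD1 i)//= lerDl sumr_ge0.
have sle i : `|s i| <= \sum_i `|s i|.
  by rewrite (bigD1 i)//= lerDl sumr_ge0.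
case: k xM => [|k] xM.
  rewrite B_seq0 normrM ler_pM ?xM// (le_trans (rle _))// lerDl sumr_ge0//.
rewrite B_seqS (le_trans (ler_normD _ _))// !normrM mulrDl.
by rewrite lerD ?ler_pM ?xM//= ?leqnSn.
Qed.

Lemma B_seq_c0 (x : c0 R) : B_seq x \in @c0_pred R.
Proof.
rewrite inE /=; apply/cvgr0Pnorm_le => e e0.
have b0 : 0 <= B_bound by rewrite addr_ge0 ?sumr_ge0.
have b1 : 0 < B_bound + 1 by rewrite ltr_wpDl.
have /cvgr0Pnorm_le /(_ (e / (B_bound + 1))) := @c0_cvg R x.
rewrite divr_gt0// => /(_ isT) [N _ HN].
exists N.+1 => // k /= Nk; apply: (@le_trans _ _ (B_bound * (e / (B_bound + 1)))); first apply: B_seq_le.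
  by move=> j kj; apply: HN => /=; rewrite (leq_trans _ kj)// -ltnS (ltn_predK Nk).
by rewrite mulrCA ler_piMr ?(ltW e0)// ler_pdivrMr// mul1r lerDl.
Qed.

Definition B_op (x : c0 R) : c0 R := C0 (B_seq_c0 x).

Lemma B_op_linear : linear B_op.
Proof.
move=> a x y; apply/val_inj/funext => k /=.
transitivity (\sum_(j < k.+1) (a * (B_mx k j * x j) + B_mx k j * y j) : R[i]).
  apply: eq_bigr => j _; rewrite [X in _ * X = _](_ : _ = a * x j + y j)//.
  by rewrite mulrDr mulrCA.
by rewrite big_split /= -mulr_sumr.
Qed.

HB.instance Definition _ :=
  GRing.isLinear.Build R[i] (c0 R) (c0 R) *:%R B_op B_op_linear.

Lemma B_op_bounded (x : c0 R) : `|B_op x| <= B_bound * `|x|.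
Proof.
apply: c0_norm_le => k; apply: B_seq_le => j _; exact: c0_norm_ub.
Qed.

End OperatorB.

(* Main.v *)
Require Import Defs.
From mathcomp Require Import all_boot all_order all_algebra.
From mathcomp Require Import all_classical all_reals all_analysis.
From mathcomp Require Import zify ring.
Import Order.TTheory GRing.Theory Num.Theory.
Import numFieldNormedType.Exports.
Local Open Scope classical_set_scope.
Local Open Scope ring_scope.

(* Write T = B - l and d_k = r_(k mod 4) - l, and read s_k modulo 6, so that d and
   s are 12-periodic. Up to scaling, the only sequence f ([ann] below) with
   sum_k f_k (Tx)_k = 0 for all finitely supported x is f_(k+1) = - (d_k / s_k) f_k,
   and |f| is multiplied by q = prod |d_i| / |s_i| ([ratio] below) over a period.
   - If q < 1, then f is summable and annihilates the range, which is not dense.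
   - If q > 1, then solving Tx = y forwards contracts by 1 / q over a period, so
     T is bounded below.
   - If q = 1, then |f| and 1 / |f| are bounded. With x_k = u_k / (d_k f_k) one
     has (Tx)_(k+1) = (u_(k+1) - u_k) / f_(k+1): a tent-shaped u of growing height
     shows that T is not bounded below, and partial sums u show that every
     finitely supported z with sum_k f_k z_k = 0 lies in the range. Such z are
     dense, since the defect of the sum can be spread over many coordinates. *)

(** * Periodic sequences *)

Section PeriodicSequences.
Context {K : numDomainType} {a : nat -> K} {p : nat}.
Hypothesis a_periodic : forall k, a (k + p)%N = a k.

Lemma periodic_modn k : a k = a (k %% p)%N.
Proof.
rewrite {1}(divn_eq k p) addnC.
by elim: (k %/ p)%N => [|q IH]; rewrite ?addn0// mulSnr addnA a_periodic.
Qed.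

(** Moving the window by one drops its first factor and appends an equal one at the end. *)
Lemma periodic_prod k : \prod_(i < p) a (k + i)%N = \prod_(i < p) a i.
Proof.
elim: k => [//|k <-]; move: a_periodic; case: p => [|q] aq.
  by rewrite !big_ord0.
rewrite big_ord_recr big_ord_recl /= addSnnS aq mulrC addn0; congr (_ * _).
by apply: eq_bigr => i _; rewrite addSnnS.
Qed.

Lemma periodic_bounded : (0 < p)%N ->
  exists2 M : K, 0 <= M & forall k, `|a k| <= M.
Proof.
move=> p_gt0; exists (\sum_(i < p) `|a i|); first exact: sumr_ge0.
move=> k; rewrite periodic_modn.
by rewrite (bigD1 (Ordinal (ltn_pmod k p_gt0)))//= lerDl sumr_ge0.
Qed.

End PeriodicSequences.

(** * Density, bounded inverses and elements of [c0] *)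

Lemma normc_archi (R : realType) (x : R[i]) : exists n : nat, `|x| < n%:R.
Proof.
exists (Num.bound (Normc.normc x)).
have -> : `|x| = (Normc.normc x)%:C%C by [].
have := @archi_boundP R (Normc.normc x).
rewrite -ltcR rmorph_nat; apply.
by rewrite -lecR; exact: (normr_ge0 x).
Qed.

Lemma denseP (K : numFieldType) (V : normedModType K) (A : set V) :
  dense A <-> forall x e, 0 < e -> exists2 y, A y & `|x - y| <= e.
Proof.
split=> [dA x e e0|dA O [x Ox] oO].
  have [|y [xy Ay]] := dA (ball x e) _ (ball_open x e).
    by exists x; exact: ballxx.
  by exists y => //; rewrite -ball_normE in xy; exact: ltW.
have /nbhs_ballP[e /= e0 xeO] : nbhs x O by apply: open_nbhs_nbhs.
have [y Ay xye] := dA x (e / 2) (divr_gt0 e0 (ltr0Sn _ 1)).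
exists y; split=> //; apply: xeO; rewrite -ball_normE /=.
by rewrite (le_lt_trans xye)// ltr_pdivrMr// ltr_pMr// ltr1n.
Qed.

Lemma has_bounded_inverseP (K : numFieldType) (X : normedModType K)
    (T : X -> X) :
  injective T ->
  has_bounded_inverse T <-> exists M : K, forall x, `|x| <= M * `|T x|.
Proof.
move=> injT; split=> [[g gK [M gM]]|[M TM]].
  by exists M => x; rewrite -{1}(gK x); apply: gM; exists x.
pose g y := xget 0 [set x | T x = y].
have gK : cancel T g.
  by move=> x; apply/injT/(xgetPex 0 (P := [set z | T z = T x])); exists x.
by exists g => //; exists M => _ [x _ <-]; rewrite gK.
Qed.

Section C0Facts.
Context {R : realType}.

Lemma finite_support_c0 (x : nat -> R[i]^o) (n : nat) :
  (forall k, (n <= k)%N -> x k = 0) -> x \in @c0_pred R.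
Proof.
by move=> x0; rewrite inE; apply: cvg_near_cst; exists n.
Qed.

Lemma c0_eventually_lt (x : c0 R) (e : R[i]) :
  0 < e -> exists n : nat, forall k, (n <= k)%N -> `|x k| < e.
Proof.
by move=> e0; have /cvgr0Pnorm_lt/(_ e e0)[n _ xn] := @c0_cvg R x; exists n.
Qed.

End C0Facts.
Arguments c0_eventually_lt {R} x {e}.

(** * Lower bidiagonal operators with periodic diagonals *)

Section Bidiagonal.
Variables (R : realType) (d s : nat -> R[i]) (p : nat).
Variable T : c0 R -> c0 R.
Hypothesis T0 : forall x, T x 0%N = d 0%N * x 0%N :> R[i].
Hypothesis TS : forall x k, T x k.+1 = d k.+1 * x k.+1 + s k * x k :> R[i].
Hypothesis p_gt0 : (0 < p)%N.
Hypothesis d_periodic : forall k, d (k + p)%N = d k.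
Hypothesis s_periodic : forall k, s (k + p)%N = s k.
Hypothesis s_neq0 : forall k, s k != 0.

Definition ann k : R[i] := \prod_(i < k) (- d i / s i).
Definition ratio : R[i] := \prod_(i < p) (`|d i| / `|s i|).

Lemma annS k : ann k.+1 = ann k * (- d k / s k).
Proof. by rewrite /ann big_ord_recr. Qed.

Lemma ratio_ge0 : 0 <= ratio.
Proof. by apply: prodr_ge0 => i _; rewrite divr_ge0. Qed.

Lemma norm_ann_period k : `|ann (k + p)| = ratio * `|ann k|.
Proof.
rewrite /ann big_split_ord /= normrM mulrC; congr (_ * _).
have per j : `|d (j + p)%N| / `|s (j + p)%N| = `|d j| / `|s j|.
  by rewrite d_periodic s_periodic.
rewrite normr_prod -[RHS](periodic_prod per k).
by apply: eq_bigr => i _; rewrite normrM normrN normfV.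
Qed.

(** Telescoping: [ann k.+1 * s k = - ann k * d k], so the subdiagonal term of each row cancels what
    the previous rows leave over. *)
Lemma sum_ann_T x n :
  \sum_(k < n.+1) ann k * T x k = ann n * (d n * x n) :> R[i].
Proof.
elim: n => [|n IH]; first by rewrite big_ord1 T0.
rewrite big_ord_recr /= IH TS mulrDr addrCA [X in _ + X](_ : _ = 0) ?addr0//.
by rewrite annS -mulrA -mulrDr (mulrA (- d n / s n)) divfK// mulNr subrr mulr0.
Qed.

(** * The case [ratio < 1]: the range is not dense *)

Lemma sum_norm_ann_bounded : ratio < 1 ->
  exists2 F, 0 < F & forall n, \sum_(k < n) `|ann k| <= F.
Proof.
move=> r1; have r10 : 0 < 1 - ratio by rewrite subr_gt0.
(* If S_n is the n-th partial sum, then S_p + [ratio] S_n = S_(n+p) >= S_n. The added 1 makes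
   positivity immediate. *)
exists ((\sum_(k < p) `|ann k| + 1) / (1 - ratio)).
  by rewrite divr_gt0// ltr_wpDl// sumr_ge0.
move=> n; rewrite ler_pdivlMr// mulrBr mulr1 lerBlDr.
have -> : (\sum_(k < n) `|ann k|) * ratio = \sum_(k < n) `|ann (p + k)|.
  rewrite mulr_suml; apply: eq_bigr => k _.
  by rewrite addnC norm_ann_period mulrC.
have sumD m l :
    \sum_(k < m + l) `|ann k| =
    \sum_(k < m) `|ann k| + \sum_(k < l) `|ann (m + k)|.
  by rewrite big_split_ord.
by rewrite addrAC -sumD addnC sumD -addrA lerDl addr_ge0// sumr_ge0.
Qed.

(** The first unit vector [e0] pairs with [ann] to 1. If [T x] were within 1/(2F) of it, then 1
    would be the pairing of [ann] with [e0 - T x], at most 1/2, plus the boundary term of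
    [sum_ann_T], which is below 1/2 for large n. *)
Lemma not_dense_range : ratio < 1 -> ~ dense (range T).
Proof.
move=> r1 /denseP dT; have [F F0 annF] := sum_norm_ann_bounded r1.
have [D D0 dD] := periodic_bounded d_periodic p_gt0.
pose e0 (k : nat) : R[i]^o := (k == 0%N)%:R.
have e0c : e0 \in @c0_pred R by apply: (@finite_support_c0 _ _ 1) => -[].
have [|_ [x _ <-] e0Tx] := dT (C0 e0c) (2 * F)^-1.
  by rewrite invr_gt0 mulr_gt0.
(* [D] may be 0, hence the division by [D + 1]. *)
have D1 : 0 < D + 1 by rewrite ltr_wpDl.
have eps0 : 0 < (2 * (F * (D + 1)))^-1 by rewrite invr_gt0 !mulr_gt0.
have [n /(_ n (leqnn n)) xn] := c0_eventually_lt x eps0.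
have : \sum_(k < n.+1) ann k * (e0 k - T x k : R[i]) = 1 - ann n * (d n * x n).
  rewrite -sum_ann_T -[1](_ : \sum_(k < n.+1) ann k * e0 k = 1).
    by rewrite -sumrB; apply: eq_bigr => k _; rewrite mulrBr.
  rewrite big_ord_recl big1 ?addr0 => [|i _]; last by rewrite mulr0.
  by rewrite /ann big_ord0 mulr1.
move/eqP; rewrite eq_sym subr_eq => /eqP sum1.
have : (1 : R[i]) < 1; last by rewrite ltxx.
rewrite {2}(splitr 1) -[X in X < _]normr1 {1}sum1.
rewrite (le_lt_trans (ler_normD _ _))// ler_ltD//.
  rewrite (le_trans (ler_norm_sum _ _ _))//.
  apply: (@le_trans _ _ (\sum_(k < n.+1) `|ann k| * (2 * F)^-1)).
    apply: ler_sum => k _; rewrite normrM ler_wpM2l//.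
    exact: le_trans (c0_norm_ub (C0 e0c - T x) k) e0Tx.
  rewrite -mulr_suml invfM mulrCA mul1r ler_piMr ?invr_ge0// ler_pdivrMr// mul1r.
  exact: annF.
have annFn : `|ann n| <= F.
  by rewrite (le_trans _ (annF n.+1))// big_ord_recr lerDr sumr_ge0.
apply: (@le_lt_trans _ _ (F * ((D + 1) * `|x n|))).
  rewrite !normrM ler_pM ?mulr_ge0// ler_wpM2r// (le_trans (dD n))//.
  by rewrite lerDl.
rewrite mulrA -ltr_pdivlMl ?mulr_gt0// (lt_le_trans xn)//.
by rewrite mul1r invfM mulrC.
Qed.

(** * The case [ratio > 1]: a lower bound for T *)

Lemma T_bounded_below : (forall k, d k != 0) -> ratio^-1 < 1 ->
  exists M : R[i], forall x, `|x| <= M * `|T x|.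
Proof.
move=> d_neq0 r1.
pose a k : R[i] := `|s k| / `|d k.+1|.
have per k : a (k + p)%N = a k by rewrite /a -addSn d_periodic s_periodic.
have prod_a : \prod_(i < p) a i = ratio^-1.
  have dper k : `|d (k + p)%N| = `|d k| by rewrite d_periodic.
  (* The denominators of [a] are shifted by one index, which does not change their product over a
     period. *)
  rewrite /a /ratio !big_split /= !prodfV mulrC invfM invrK; congr (_^-1 * _).
  by have := periodic_prod dper 1.
have a_ge0 k : 0 <= a k by rewrite /a divr_ge0.
have [A A0 aA'] := periodic_bounded per p_gt0.
have aA k : a k <= A by have := aA' k; rewrite ger0_norm.
have [B B0 bB] : exists2 B : R[i], 0 <= B & forall k, `|(d k)^-1| <= B.
  by apply: periodic_bounded p_gt0 => k; rewrite d_periodic.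
(* [C n] bounds the error gathered in n steps of the recursion [xS], each adding at most [B * |T x|]
   and multiplying the earlier error by at most [A]. *)
pose C n : R[i] := \sum_(i < n) A ^+ i * B.
have C0 n : 0 <= C n by rewrite sumr_ge0// => i _; rewrite mulr_ge0// exprn_ge0.
have CS n : C n.+1 = A * C n + B.
  rewrite /C big_ord_recl mul1r addrC mulr_sumr; congr (_ + _).
  by apply: eq_bigr => i _; rewrite mulrA -exprS.
have xS (x : c0 R) k : `|x k.+1| <= a k * `|x k| + B * `|T x|.
  have -> : x k.+1 = (d k.+1)^-1 * (T x k.+1 - s k * x k) :> R[i].
    by rewrite TS addrK mulKf.
  rewrite normrM (le_trans (ler_wpM2l (normr_ge0 _) (ler_normB _ _)))//.
  rewrite mulrDr addrC lerD//; last by rewrite ler_pM ?bB// c0_norm_ub.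
  by rewrite normrM normfV mulrA [_^-1 * _]mulrC.
clearbody a.
have x_head (x : c0 R) k : `|x k| <= C k.+1 * `|T x|.
  elim: k => [|k IH].
    have -> : x 0%N = (d 0%N)^-1 * T x 0%N :> R[i] by rewrite T0 mulKf.
    by rewrite /C big_ord1 expr0 mul1r normrM ler_pM ?bB ?c0_norm_ub.
  rewrite (le_trans (xS x k))// CS mulrDl lerD2r -[leRHS]mulrA.
  by rewrite ler_pM.
have x_shift (x : c0 R) k n :
    `|x (k + n)%N| <= (\prod_(i < n) a (k + i)%N) * `|x k| + C n * `|T x|.
  elim: n => [|n IH].
    by rewrite big_ord0 /C big_ord0 mul0r addr0 mul1r addn0.
  rewrite addnS (le_trans (xS x _))// big_ord_recr CS /=.
  rewrite mulrDl addrA lerD2r (le_trans (ler_wpM2l _ IH))//.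
  by rewrite mulrDr !mulrA [a _ * _]mulrC lerD2l !ler_wpM2r.
have r1' : 0 < 1 - ratio^-1 by rewrite subr_gt0.
exists (C p / (1 - ratio^-1)) => x.
rewrite mulrAC ler_pdivlMr// mulrBr mulr1 lerBlDr.
(* Entries before p are bounded directly; a later one is compared with the entry p places earlier,
   which costs a factor [ratio^-1]. The resulting term [ratio^-1 * |x|] has been moved to the right,
   to be absorbed since [ratio^-1 < 1]. *)
apply: c0_norm_le => k; have [kp|pk] := ltnP k p.
  apply: ler_wpDr; first by rewrite mulr_ge0// invr_ge0 ratio_ge0.
  rewrite (le_trans (x_head x k))// ler_wpM2r// -(subnKC kp).
  rewrite [leRHS]big_split_ord lerDl sumr_ge0// => i _.
  by rewrite mulr_ge0// exprn_ge0.
rewrite -(subnK pk) (le_trans (x_shift x _ _))// (periodic_prod per) prod_a addrC.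
by rewrite lerD2l mulrC ler_wpM2r ?c0_norm_ub// invr_ge0 ratio_ge0.
Qed.

(** * The case [ratio = 1]: dense range and no lower bound *)

Lemma ann_neq0 : (forall k, d k != 0) -> forall k, ann k != 0.
Proof.
move=> d_neq0 k; apply/prodf_neq0 => i _.
by rewrite mulf_neq0 ?oppr_eq0// invr_neq0.
Qed.

Lemma ann_bounds : (forall k, d k != 0) -> ratio = 1 ->
  exists F : R[i], [/\ 0 < F, forall k, `|ann k| <= F &
                    forall k, `|(ann k)^-1| <= F].
Proof.
move=> d_neq0 r1.
have per k : `|ann (k + p)| = `|ann k| by rewrite norm_ann_period r1 mul1r.
have perV k : `|(ann (k + p))^-1| = `|(ann k)^-1| by rewrite !normfV per.
have [F F0 annF] := periodic_bounded per p_gt0.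
have [G G0 annG] := periodic_bounded perV p_gt0.
exists (F + G + 1); split=> [|k|k]; first by rewrite ltr_wpDl// addr_ge0.
  by rewrite -addrA ler_wpDr ?addr_ge0// -normr_id.
by rewrite addrAC ler_wpDl ?addr_ge0// -normr_id.
Qed.

Lemma T_injective : (forall k, d k != 0) -> injective T.
Proof.
move=> d_neq0 x y Txy; apply/val_inj/funext => k /=.
elim: k => [|k IH].
  by apply: (mulfI (d_neq0 0%N)); rewrite -!T0 Txy.
apply: (mulfI (d_neq0 k.+1)); apply: (addIr (s k * x k)).
by rewrite -TS Txy TS IH.
Qed.

(** The recursion for [ann] gives [s k / (d k * ann k) = - (ann k.+1)^-1], so the substitution turns
    T into a weighted difference operator. *)
Lemma T_div_ann (u : nat -> R[i]) (x : c0 R) : (forall k, d k != 0) ->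
  (forall k, x k = u k / (d k * ann k) :> R[i]) ->
  T x 0%N = u 0%N :> R[i] /\
  forall k, T x k.+1 = (u k.+1 - u k) / ann k.+1 :> R[i].
Proof.
move=> d_neq0 xE; split=> [|k].
  by rewrite T0 xE /ann big_ord0 mulr1 mulrC divfK.
rewrite TS !xE annS.
by field; rewrite s_neq0 ann_neq0 ?d_neq0.
Qed.

Lemma range_ann (z : c0 R) n : (forall k, d k != 0) ->
  (forall k, (n <= k)%N -> z k = 0) -> \sum_(k < n) ann k * z k = 0 :> R[i] ->
  range T z.
Proof.
move=> d_neq0 z0 sum0.
pose u k : R[i] := \sum_(j < k.+1) ann j * z j.
(* [u k] already contains the term of index k, so it vanishes from k = n - 1 on, and the preimage
   has finite support. *)
have u0 k : (n <= k.+1)%N -> u k = 0.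
  move=> nk; rewrite /u -(subnKC nk) big_split_ord /= sum0 add0r big1// => i _.
  by rewrite z0 ?leq_addr// mulr0.
pose x k : R[i]^o := u k / (d k * ann k).
have xc : x \in @c0_pred R.
  apply: (@finite_support_c0 _ _ n) => k nk; rewrite /x u0 ?mul0r//.
  exact: leq_trans nk _.
have [Tx0 TxS] := T_div_ann u (C0 xc) d_neq0 (fun=> erefl).
exists (C0 xc) => //; apply/val_inj/funext => -[|k] /=.
  by rewrite Tx0 /u big_ord1 /ann big_ord0 mul1r.
rewrite TxS /u big_ord_recr /= addrAC subrr add0r mulrC mulKf//.
exact: ann_neq0.
Qed.

Lemma dense_range : (forall k, d k != 0) -> ratio = 1 -> dense (range T).
Proof.
move=> d_neq0 r1; have f_neq0 := ann_neq0 d_neq0.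
have [F [F0 _ annF]] := ann_bounds d_neq0 r1.
apply/denseP => y e e0.
have e20 : 0 < e / 2 by rewrite divr_gt0.
have [n yn] := c0_eventually_lt y e20.
(* [al] is the defect of y truncated at n. Each of the next N coordinates of z cancels [al / N] of
   it, and N is so large that these coordinates have modulus at most e/2. *)
pose al : R[i] := \sum_(k < n) ann k * y k.
have [N alN] := normc_archi R (al * F / (e / 2)).
have N0 : 0 < N%:R :> R[i] := le_lt_trans (normr_ge0 _) alN.
rewrite !normrM (gtr0_norm F0) normfV (gtr0_norm e20) in alN.
pose z k : R[i]^o :=
  if (k < n)%N then y k else if (k < n + N)%N then - (al / N%:R / ann k) else 0.
have z0 k : (n + N <= k)%N -> z k = 0.
  move=> nNk; rewrite /z !ltnNge nNk (leq_trans _ nNk) ?leq_addr//.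
have zc : z \in @c0_pred R by apply: finite_support_c0 z0.
exists (C0 zc).
  apply: (range_ann (C0 zc) (n + N) d_neq0 z0); rewrite big_split_ord /=.
  have -> : \sum_(k < n) ann k * z k = al.
    by apply: eq_bigr => k _; rewrite /z ltn_ord.
  rewrite (eq_bigr (fun=> - (al / N%:R))) => [|k _].
    rewrite sumr_const card_ord mulNrn -[_ / _ *+ _]mulr_natr divfK ?subrr//.
    by rewrite gt_eqF.
  rewrite /z ltnNge leq_addr /= ltn_add2l ltn_ord mulrN mulrC divfK//.
apply: c0_norm_le => k; rewrite [X in `|X|](_ : _ = y k - z k)// /z.
have [kn|nk] := ltnP k n; first by rewrite subrr normr0 ltW.
have yk := ltW (yn k nk).
have e2e : e / 2 <= e by rewrite ler_pdivrMr// ler_peMr ?ltW// ltr1n.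
case: ifP => _; last by rewrite subr0 (le_trans yk).
rewrite opprK (splitr e) (le_trans (ler_normD _ _))// lerD//.
rewrite !normrM normfV (gtr0_norm N0).
apply: (@le_trans _ _ (`|al| / N%:R * F)).
  by rewrite ler_wpM2l ?annF// divr_ge0 ?ltW.
by rewrite mulrAC ler_pdivrMr// [leRHS]mulrC -ler_pdivrMr// ltW.
Qed.

Lemma not_bounded_below : (forall k, d k != 0) -> ratio = 1 ->
  ~ exists M : R[i], forall x, `|x| <= M * `|T x|.
Proof.
move=> d_neq0 r1 [M TM].
have [F [F0 annF annVF]] := ann_bounds d_neq0 r1.
have [D D0 dD] := periodic_bounded d_periodic p_gt0.
have [n Mn] := normc_archi R (M * F * (D * F)).
(* The tent climbs from 1 at k = 0 to n + 1 at k = n and descends to 0 at k = 2n + 1; truncated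
   subtraction keeps it 0 afterwards. *)
pose w k := minn k.+1 (n.*2.+1 - k).
pose u k : R[i] := (w k)%:R.
pose x k : R[i]^o := u k / (d k * ann k).
have xc : x \in @c0_pred R.
  apply: (@finite_support_c0 _ _ n.*2.+1) => k nk; rewrite /x /u.
  rewrite [w k](_ : _ = 0%N) ?mul0r// /w; lia.
have [Tx0 TxS] := T_div_ann u (C0 xc) d_neq0 (fun=> erefl).
have u_step k : `|u k.+1 - u k| <= 1.
  have : w k.+1 = w k \/ w k.+1 = (w k).+1 \/ w k = (w k.+1).+1.
    by rewrite /w; lia.
  rewrite /u => -[->|[->|->]]; first by rewrite subrr normr0.
    by rewrite -natr1 addrAC subrr add0r normr1.
  by rewrite -natr1 opprD addrA subrr sub0r normrN normr1.
have T_le : `|T (C0 xc)| <= F.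
  apply: c0_norm_le => -[|k].
    rewrite Tx0 /u [w 0%N](_ : _ = 1%N); last by rewrite /w; lia.
    by have := annVF 0%N; rewrite /ann big_ord0 invr1.
  by rewrite TxS normrM (le_trans _ (annVF k.+1))// ler_piMl.
have x_le : `|x n| <= `|M * F|.
  rewrite (le_trans (c0_norm_ub (C0 xc) n))// (le_trans (TM _))//.
  (* The complex number [M] has no assumed sign, but [M * |T x|] dominates a norm and so equals its
     own modulus. *)
  have M0 : 0 <= M * `|T (C0 xc)| := le_trans (normr_ge0 _) (TM _).
  by rewrite -(ger0_norm M0) !normrM normr_id (gtr0_norm F0) ler_wpM2l.
(* At the peak, n + 1 = [|x n| * |d n| * |ann n|], whereas n was chosen above the right-hand
   side. *)
have : (n.+1)%:R <= `|M * F| * (D * F).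
  have -> : n.+1%:R = `|x n| * (`|d n| * `|ann n|).
    rewrite -!normrM /x divfK ?mulf_neq0 ?ann_neq0// /u normr_nat.
    by congr _%:R; rewrite /w; lia.
  by rewrite ler_pM// ler_pM// -normr_id.
have DF0 : 0 <= D * F by rewrite mulr_ge0// ltW.
rewrite -[D * F]ger0_norm// -normrM => /le_lt_trans/(_ Mn).
by rewrite ltr_nat ltnNge leqnSn.
Qed.

(** * The criterion over one period *)

Lemma continuous_spectrum_criterion :
  [/\ injective T, dense (range T) & ~ has_bounded_inverse T] <->
  \prod_(i < p) `|d i| = \prod_(i < p) `|s i|.
Proof.
have S_gt0 : 0 < \prod_(i < p) `|s i|.
  by apply: prodr_gt0 => i _; rewrite normr_gt0.
have ratioE : ratio = \prod_(i < p) `|d i| / \prod_(i < p) `|s i|.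
  by rewrite /ratio big_split /= prodfV.
have d_neq0 : 0 < ratio -> forall k, d k != 0.
  move=> r0 k; rewrite (periodic_modn d_periodic).
  apply: contraTneq r0 => d0.
  rewrite /ratio (bigD1 (Ordinal (ltn_pmod k p_gt0)))//= d0.
  by rewrite normr0 !mul0r ltxx.
have -> : \prod_(i < p) `|d i| = \prod_(i < p) `|s i| <-> ratio = 1.
  rewrite ratioE; split=> [->|/divr1_eq//].
  by rewrite divff// gt_eqF.
split=> [[injT denT nbT]|r1].
  (* The order on [R[i]] is partial; [ratio] and 1 are comparable because both are real. A vanishing
     [d k] falls under [ratio < 1]. *)
  have [r1|r1|//] := @real_ltgtP _ ratio 1 (ger0_real ratio_ge0) (ger0_real ler01).
    by case: (not_dense_range r1).
  case: nbT; apply/(has_bounded_inverseP _ _ _ injT)/T_bounded_below.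
    by apply: d_neq0; exact: lt_trans r1.
  by rewrite invf_lt1// (lt_trans _ r1).
have dn0 : forall k, d k != 0 by apply: d_neq0; rewrite r1.
split; [exact: T_injective|exact: dense_range|].
move/(has_bounded_inverseP _ _ _ (T_injective dn0)).
exact: not_bounded_below.
Qed.

End Bidiagonal.

(** * From the period 12 to fourth and sixth roots *)

Lemma prod_inord_modn (K : comPzSemiRingType) (m n : nat) (g : 'I_m.+1 -> K) :
  \prod_(i < n * m.+1) g (inord (i %% m.+1)) = (\prod_(i < m.+1) g i) ^+ n.
Proof.
elim: n => [|n IH]; first by rewrite big_ord0.
rewrite mulSn big_split_ord exprS -IH; congr (_ * _); apply: eq_bigr => i _ /=.
  by rewrite modn_small// inord_val.
by rewrite modnDl.
Qed.

(** Both equalities are compared through twelfth powers, and this power is injective on nonnegative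
    elements. *)
Lemma eq_rootC_4_6 (K : numClosedFieldType) (x y : K) : 0 <= x -> 0 <= y ->
  4.-root x = 6.-root y <-> x ^+ 3 = y ^+ 2.
Proof.
move=> x0 y0; rewrite -{2}(rootCK (n := 4) isT x) -{2}(rootCK (n := 6) isT y).
rewrite -!exprM; split=> [->//|/eqP].
by rewrite eqrXn2 ?rootC_ge0// => /eqP.
Qed.

Theorem theorem4p6 (R : realType) (r : 'I_4 -> R[i]) (s : 'I_6 -> R[i])
    (hs : forall i, s i != 0) :
  continuous_spectrum (B_op r s) =
  [set l : R[i] | 4.-root (\prod_(i < 4) `|l - r i|) =
                  6.-root (\prod_(i < 6) `|s i|)].
Proof.
rewrite predeqE => l /=.
pose d k : R[i] := r (inord (k %% 4)) - l.
pose s' k : R[i] := s (inord (k %% 6)).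
(* 12 is the least common multiple of 4 and 6: a period runs three times through r and twice through
   s. *)
have prodd : \prod_(i < 12) `|d i| = (\prod_(i < 4) `|l - r i|) ^+ 3.
  rewrite -prod_inord_modn; apply: eq_bigr => i _.
  by rewrite /d distrC.
have prods : \prod_(i < 12) `|s' i| = (\prod_(i < 6) `|s i|) ^+ 2.
  by rewrite -prod_inord_modn.
rewrite eq_rootC_4_6 ?prodr_ge0// -prodd -prods.
apply: continuous_spectrum_criterion => //.
- by move=> x; rewrite mulrBl -(B_seq0 r s).
- by move=> x k; rewrite mulrBl addrAC -B_seqS.
- by move=> k; rewrite /d -modnDmr addn0.
- by move=> k; rewrite /s' -modnDmr addn0.
- by move=> k; apply: hs.
Qed.
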